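(* Let $\varphi$ be a satisfiable LTL formula over the variables in $\mathcal{I}\cup\mathcal{O}$, given as input to the algorithm $\mathcal{NDC}$ described in the context. Then (whatever the choices of variables made by the algorithm and whatever falsifying traces are returned by the validity checker) each iteration of the main loop of $\mathcal{NDC}$ computes a set $V\subseteq\mathcal{O}$ that is independent in $\varphi$ and has no non-empty proper subset $U\subsetneq V$ that is independent in $\varphi$.
   Context: Propositional variables are split into two disjoint sets: $\mathcal{I}$ (controlled by the environment) and the finite set $\mathcal{O}$ (controlled by the system). $\mathcal{O}'=\{y'\mid y\in\mathcal{O}\}$ is a set of fresh primed copies of the variables in $\mathcal{O}$. LTL formulae are built from variables with $\neg,\wedge$, $\bigcirc$ (next), $\mathcal{U}$ (until) and the usual abbreviations $\mathbf{F}$ (the constant false), $\vee,\to,\leftrightarrow$, $\Diamond$ (eventually), $\Box$ (always). They are interpreted with the standard semantics, evaluated at position $0$, over traces, i.e. infinite sequences $\sigma=\sigma_0,\sigma_1,\dots$ of sets of variables ($\sigma_i$ is the set of variables true at time $i$). A formula is valid if all traces (over the variables $\mathcal{I}\cup\mathcal{O}\cup\mathcal{O}'$) satisfy it. For $V\subseteq\mathcal{O}$ put $\overline V=\mathcal{O}\setminus V$. The projection formula $\varphi_V$ is obtained from $\varphi$ by replacing every variable $w\in\overline V$ by its primed copy $w'$ (variables in $\mathcal{I}\cup V$ are unchanged). Independence: $V\subseteq\mathcal{O}$ is independent in $\varphi$ iff the formula $(\varphi_V\wedge\varphi_{\overline V})\to\varphi$ is valid. CheckValidity$(\Phi)$ returns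 $(\mathit{true},\cdot)$ if the LTL formula $\Phi$ is valid, and otherwise returns $(\mathit{false},\sigma)$, where $\sigma$ is some (arbitrary) trace over $\mathcal{I}\cup\mathcal{O}\cup\mathcal{O}'$ with $\sigma\not\models\Phi$. Algorithm $\mathcal{NDC}$ (input: a satisfiable LTL formula $\varphi$ over $\mathcal{I}\cup\mathcal{O}$; output: $\mathit{clusters}$): - Set $\mathit{clusters}:=\emptyset$, $R:=\mathcal{O}$. - Main loop: while $R\neq\emptyset$: choose any $x\in R$; set $V:=\{x\}$; repeat the following inner loop until $\mathit{passed}$ is true: [$\overline V:=\mathcal{O}\setminus V$; $(\mathit{passed},\sigma):=$ CheckValidity$((\varphi_V\wedge\varphi_{\overline V})\to\varphi)$; if not $\mathit{passed}$, then $D:=$ NewParseTrace$(\varphi,V,\sigma)$ and $V:=V\cup D$]. Then set $\mathit{clusters}:=\mathit{clusters}\cup\{V\}$ and $R:=\mathcal{O}\setminus\bigcup_{S\in\mathit{clusters}}S$. This final $V$ is the set computed by the iteration of the main loop. - Return $\mathit{clusters}$. NewParseTrace$(\varphi,V,\sigma)$, where $\sigma\models\varphi_V\wedge\varphi_{\overline V}\wedge\neg\varphi$: - Set $\mathit{passed}:=\mathit{false}$, $\mathit{binds}:=\mathbf{F}$, $\tau:=\sigma$. - While not $\mathit{passed}$: let $Z:=\{z\in\overline V : \text{for some } i\ge 0,\ (z\in\tau_i \text{ iff } z'\notin\tau_i)\}$; let $z$ be any variable in $Z$; set $\mathit{binds}:=\mathit{binds}\vee\Diamond(z\leftrightarrow\neg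 z')$; set $(\mathit{passed},\tau):=$ CheckValidity$(\mathit{binds}\vee((\varphi_V\wedge\varphi_{\overline V})\to\varphi))$. - Return $\{z\}$ (the last variable chosen). *)

(* Defs.v *)
From mathcomp Require Import all_boot.
From Stdlib Require Import Relation_Operators.

Set Implicit Arguments.
Unset Strict Implicit.
Unset Printing Implicit Defensive.

(* Falsity is a primitive rather than an abbreviation [p /\ ~ p], so that it
   exists over an empty set of variables as well. *)
Inductive ltl (X : Type) : Type :=
| Var (x : X)
| Bot
| Neg (f : ltl X)
| And (f g : ltl X)
| Next (f : ltl X)
| Until (f g : ltl X).

Arguments Bot {X}.

Section Abbreviations.
Variable X : Type.
Implicit Types f g : ltl X.

Definition Top : ltl X := Neg Bot.
Definition Or f g : ltl X := Neg (And (Neg f) (Neg g)).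
Definition Imp f g : ltl X := Or (Neg f) g.
Definition Iff f g : ltl X := And (Imp f g) (Imp g f).
Definition Eventually f : ltl X := Until Top f.
Definition Always f : ltl X := Neg (Eventually (Neg f)).
End Abbreviations.

Fixpoint rename (X Y : Type) (r : X -> Y) (f : ltl X) : ltl Y :=
  match f with
  | Var x => Var (r x)
  | Bot => Bot
  | Neg g => Neg (rename r g)
  | And g h => And (rename r g) (rename r h)
  | Next g => Next (rename r g)
  | Until g h => Until (rename r g) (rename r h)
  end.

Definition trace (X : Type) : Type := nat -> {pred X}.

Fixpoint sat (X : Type) (s : trace X) (i : nat) (f : ltl X) : Prop :=
  match f with
  | Var x => x \in s i
  | Bot => False
  | Neg g => ~ sat s i g
  | And g h => sat s i g /\ sat s i h
  | Next g => sat s i.+1 g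
  | Until g h =>
      exists j : nat,
        [/\ i <= j, sat s j h & forall k : nat, i <= k < j -> sat s k g]
  end.

Definition satisfiable (X : Type) (f : ltl X) : Prop :=
  exists s : trace X, sat s 0 f.

Definition valid (X : Type) (f : ltl X) : Prop :=
  forall s : trace X, sat s 0 f.

(* Input formulae have type [ltl (I + O)]; those handed to the validity checker
   range over the inputs, the outputs and the primed copies of the outputs. *)
Inductive var (I O : Type) : Type :=
| Env (a : I)
| Sys (y : O)
| Primed (y : O).

Arguments Env {I O} a.
Arguments Sys {I O} y.
Arguments Primed {I O} y.

Section Decomposition.
Variables (I : Type) (O : finType).
Implicit Types (phi : ltl (I + O)) (V : {set O}) (s : trace (var I O)).

Definition embed_var (v : I + O) : var I O :=
  match v with
  | inl a => Env a
  | inr y => Sys y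
  end.

Definition embed phi : ltl (var I O) := rename embed_var phi.

Definition project_var V (v : I + O) : var I O :=
  match v with
  | inl a => Env a
  | inr y => if y \in V then Sys y else Primed y
  end.

Definition projection phi V : ltl (var I O) := rename (project_var V) phi.

Definition independence_formula phi V : ltl (var I O) :=
  Imp (And (projection phi V) (projection phi (~: V))) (embed phi).

Definition independent phi V : Prop := valid (independence_formula phi V).

(* [check_validity F (b, s)]: [(b, s)] is a possible answer of the validity
   checker on [F]; on success the trace component is irrelevant. *)
Inductive check_validity (F : ltl (var I O)) : bool * trace (var I O) -> Prop :=
| check_valid s : valid F -> check_validity F (true, s)
| check_invalid s : ~ sat s 0 F -> check_validity F (false, s).

Definition differ (z : O) : ltl (var I O) :=
  Eventually (Iff (Var (Sys z)) (Neg (Var (Primed z)))).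

(* The set Z of candidates of NewParseTrace. *)
Definition candidate V s (z : O) : Prop :=
  z \in ~: V /\
  exists i : nat, (Sys z \in s i) <-> (Primed z \notin s i).

(* Control points of NDC, with the values of its live variables:
   [Main cl R]           test of the main loop;
   [Inner cl V]          start of a pass through the inner loop;
   [Parse cl V binds t]  start of a pass through the loop of NewParseTrace
                         called on V, with current trace t;
   [Computed cl V]       exit of the inner loop: V is the set computed by this
                         iteration of the main loop, not yet added to cl;
   [Return cl]           termination with output cl. *)
Inductive config : Type :=
| Main (cl : {set {set O}}) (R : {set O})
| Inner (cl : {set {set O}}) (V : {set O})
| Parse (cl : {set {set O}}) (V : {set O})
    (binds : ltl (var I O)) (t : trace (var I O))
| Computed (cl : {set {set O}}) (V : {set O})
| Return (cl : {set {set O}}).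

Inductive step phi : config -> config -> Prop :=
| step_return cl : step phi (Main cl set0) (Return cl)
| step_choose cl (R : {set O}) x :
    x \in R -> step phi (Main cl R) (Inner cl [set x])
| step_passed cl V s :
    check_validity (independence_formula phi V) (true, s) ->
    step phi (Inner cl V) (Computed cl V)
| step_failed cl V s :
    check_validity (independence_formula phi V) (false, s) ->
    step phi (Inner cl V) (Parse cl V Bot s)
| step_parse_failed cl V binds t z t' :
    candidate V t z ->
    check_validity (Or (Or binds (differ z)) (independence_formula phi V))
      (false, t') ->
    step phi (Parse cl V binds t) (Parse cl V (Or binds (differ z)) t')
| step_parse_passed cl V binds t z t' :
    candidate V t z ->
    check_validity (Or (Or binds (differ z)) (independence_formula phi V))
      (true, t') ->
    step phi (Parse cl V binds t) (Inner cl (V :|: [set z]))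
| step_record cl V :
    step phi (Computed cl V) (Main (V |: cl) (~: cover (V |: cl))).

Definition reachable phi (c : config) : Prop :=
  clos_refl_trans config (step phi) (Main set0 [set: O]) c.
End Decomposition.

Arguments Main {I O} cl R.
Arguments Inner {I O} cl V.
Arguments Computed {I O} cl V.
Arguments Return {I O} cl.

(* Total correctness under demonic nondeterminism: every execution from [c]
   reaches, after finitely many steps and without getting stuck, a state
   satisfying [post]. *)
Inductive inevitably (C : Type) (step : C -> C -> Prop) (post : C -> Prop)
    (c : C) : Prop :=
| inevitably_now : post c -> inevitably step post c
| inevitably_later :
    (exists c', step c c') ->
    (forall c', step c c' -> inevitably step post c') ->
    inevitably step post c.

(* Main.v *)
Require Import Defs.
From mathcomp Require Import all_boot.
From Stdlib Require Import Classical FunctionalExtensionality.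

Set Implicit Arguments.
Unset Strict Implicit.
Unset Printing Implicit Defensive.

(** Let [x] be the first variable chosen. Throughout the inner loop, [x \in V]
    and [V] is contained in every independent set containing [x]. As
    independent sets are closed under complement, an independent [V] with this
    property has no non-empty independent proper subset [U]: if [x \in U] then
    [V \subset U], and otherwise [V \subset ~: U].

    The invariant is preserved because NewParseTrace only returns variables [z]
    lying in every independent [W] containing [V]. Indeed, take a trace
    refuting independence of [V] on which the previously bound variables agree
    with their primed copies. If [z \notin W], resetting [y'] to [y] for every
    [y] outside [W] gives another such trace, by independence of [W]; on it
    [z] agrees with [z'] too, contradicting the final validity check. *)

Lemma eq_rename (X Y : Type) (r1 r2 : X -> Y) (f : ltl X) :
  r1 =1 r2 -> rename r1 f = rename r2 f.
Proof. by move=> e; elim: f => //= *; congruence. Qed.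

Lemma rename_comp (X Y Z : Type) (r : X -> Y) (q : Y -> Z) (f : ltl X) :
  rename q (rename r f) = rename (q \o r) f.
Proof. by elim: f => //= *; congruence. Qed.

(** Dual to [rename]: an edit of a trace becomes a substitution in the formula, so comparing
    formulae on edited traces reduces to comparing maps on variables. *)
Definition pullback (X Y : Type) (r : X -> Y) (s : trace Y) : trace X :=
  fun i x => r x \in s i.

Lemma in_pullback (X Y : Type) (r : X -> Y) (s : trace Y) i x :
  (x \in pullback r s i) = (r x \in s i).
Proof. by []. Qed.

Lemma sat_rename (X Y : Type) (r : X -> Y) (s : trace Y) (f : ltl X) i :
  sat s i (rename r f) <-> sat (pullback r s) i f.
Proof.
elim: f i => [x||f IH|f IHf g IHg|f IH|f IHf g IHg] i //=.
- by split=> nf /IH.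
- by split=> -[/IHf ? /IHg ?].
- by split=> -[j [ij gj fk]]; exists j; split=> //;
    [apply/IHg | move=> k /fk /IHf | apply/IHg | move=> k /fk /IHf].
Qed.

Lemma sat_Or (X : Type) (s : trace X) i (f g : ltl X) :
  sat s i (Or f g) <-> sat s i f \/ sat s i g.
Proof. by rewrite /Or /=; split; [move=> /not_and_or [] /NNPP | tauto]; tauto. Qed.

Lemma sat_Imp (X : Type) (s : trace X) i (f g : ltl X) :
  sat s i (Imp f g) <-> (sat s i f -> sat s i g).
Proof. by split=> [/sat_Or /= | H]; [tauto | apply/sat_Or; exact: imply_to_or]. Qed.

Lemma sat_Iff (X : Type) (s : trace X) i (f g : ltl X) :
  sat s i (Iff f g) <-> (sat s i f <-> sat s i g).
Proof. have := (sat_Imp s i f g, sat_Imp s i g f); rewrite /Iff /=; tauto. Qed.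

Section Decomposition.
Variables (I : Type) (O : finType) (phi : ltl (I + O)).
Implicit Types (V W B : {set O}) (s t : trace (var I O)) (x y z : O).
Implicit Type binds : ltl (var I O).

Definition differs s z := exists i, (Sys z \in s i) != (Primed z \in s i).

Lemma sat_differ s z : sat s 0 (differ I z) <-> differs s z.
Proof.
split=> [[i [_ H _]]|[i ne]]; exists i.
  have /= := proj1 (sat_Iff s i (Var (Sys z)) (Neg (Var (Primed z)))) H.
  by case: (Sys z \in s i) (Primed z \in s i) => [] [] //=; intuition.
split=> //; last by move=> k _ [].
apply/sat_Iff => /=.
by case: (Sys z \in s i) (Primed z \in s i) ne => [] [] //=; intuition.
Qed.

Lemma candidateE V s z : candidate V s z <-> z \notin V /\ differs s z.
Proof.
rewrite /candidate inE; split=> -[-> [i ne]]; split=> //; exists i;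
  by case: (Sys z \in s i) (Primed z \in s i) ne => [] [] //; intuition.
Qed.

Lemma refutes_independenceE V s :
  ~ sat s 0 (independence_formula phi V) <->
  [/\ sat s 0 (projection phi V), sat s 0 (projection phi (~: V))
    & ~ sat s 0 (embed phi)].
Proof.
split=> [nF|[sV sVC nE] /sat_Imp /= /(_ (conj sV sVC))] //.
by have [[]] : _ /\ _ := imply_to_and _ _ (fun H => nF (proj2 (sat_Imp _ _ _ _) H)).
Qed.

Lemma independentP V :
  independent phi V <-> forall s, sat s 0 (projection phi V) ->
    sat s 0 (projection phi (~: V)) -> sat s 0 (embed phi).
Proof.
split=> [indV s sV sVC|H s]; last by apply/sat_Imp => -[]; exact: H.
exact: (proj1 (sat_Imp _ _ _ _) (indV s) (conj sV sVC)).
Qed.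

Lemma independentC V : independent phi V -> independent phi (~: V).
Proof.
move/independentP=> indV; apply/independentP => s.
by rewrite setCK => sVC sV; exact: indV.
Qed.

(** Pulling a trace back along this map makes [y'] a copy of [y] for each [y] outside [W]. *)
Definition unprime W (v : var I O) : var I O :=
  if v is Primed y then if y \in W then Primed y else Sys y else v.

Definition swap W (v : var I O) : var I O :=
  match v with
  | Env a => Env a
  | Sys y => if y \in W then Primed y else Sys y
  | Primed y => if y \in W then Sys y else Primed y
  end.

(** The projection to [~: V] reads primed copies only of variables in [V], hence in [W], and
    [embed phi] reads none, so the reset affects neither. Only the projection to [V] changes, and
    independence of [W] restores it. *)
Lemma refutes_unprime V W s :
  independent phi W -> V \subset W ->
  ~ sat s 0 (independence_formula phi V) ->
  ~ sat (pullback (unprime W) s) 0 (independence_formula phi V).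
Proof.
move=> indW /subsetP subVW /refutes_independenceE [sV sVC nE].
have inVW y : y \in V -> y \in W by exact: subVW.
apply/refutes_independenceE; split.
- (* On the trace with [y] and [y'] exchanged for [y] in [W :\: V], the
     projections to [W] and [~: W] are the original ones to [V] and [~: V]. *)
  have : sat (pullback (swap (W :\: V)) s) 0 (embed phi).
    apply: (proj1 (independentP W) indW); apply: (proj1 (sat_rename _ _ _ _));
      rewrite /projection rename_comp.
      rewrite (@eq_rename _ _ _ (project_var V)) // => -[a|y] //=.
      by have := inVW y; case yW: (y \in W); rewrite /= ?inE yW ?andbT;
        case: (y \in V) => // /(_ isT).
    rewrite (@eq_rename _ _ _ (project_var (~: V))) // => -[a|y] //=.
    by have := inVW y; rewrite !inE; case yW: (y \in W);
      rewrite /= ?inE yW ?andbT; case: (y \in V) => // /(_ isT).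
  (* The projection to [V] on the reset trace and [embed phi] on the swapped one both read primed
     copies exactly for the variables in [W :\: V]. *)
  move/(proj2 (sat_rename _ _ _ _)) => sE; apply: (proj1 (sat_rename _ _ _ _)).
  move: sE; rewrite /embed /projection !rename_comp.
  rewrite (@eq_rename _ _ _ (unprime W \o project_var V)) // => -[a|y] //=.
  by have := inVW y; rewrite !inE; case yV: (y \in V) => //= [->|] //;
    case yW: (y \in W) => /=; rewrite ?yW.
- apply: (proj1 (sat_rename _ _ _ _)); rewrite /projection rename_comp.
  rewrite (@eq_rename _ _ _ (project_var (~: V))) // => -[a|y] //=.
  by rewrite !inE; have := inVW y; case: (y \in V) => //= ->.
- move/(proj2 (sat_rename _ _ _ _)).
  by rewrite /embed rename_comp (@eq_rename _ _ _ (@embed_var I O)) // => -[].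
Qed.

Lemma differs_unprime W s z :
  differs (pullback (unprime W) s) z -> z \in W /\ differs s z.
Proof.
move=> [i]; rewrite !in_pullback /=.
by case: (z \in W) => [ne|/negP []] //; split=> //; exists i.
Qed.

(** NewParseTrace never gets stuck: if every variable outside [V] agreed with its primed copy on
    [s], then [phi] and its projection to [V] would have the same value there. *)
Lemma candidate_exists V s :
  ~ sat s 0 (independence_formula phi V) -> exists z, candidate V s z.
Proof.
move=> /refutes_independenceE [sV _ nE]; apply: NNPP => nC; case: nE.
apply: (proj2 (sat_rename _ _ _ _)); move: sV => /(proj1 (sat_rename _ _ _ _)).
suff -> : pullback (project_var V) s = pullback (@embed_var I O) s by [].
apply: functional_extensionality => i; apply: functional_extensionality.
rewrite /pullback => -[a|y] //=; case: ifP => // yV.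
apply/eqP; apply: contraT => ne; case: nC; exists y.
by apply/candidateE; rewrite yV; split=> //; exists i; rewrite eq_sym.
Qed.

(** Excluded middle stands in for a decision procedure for LTL validity. *)
Lemma check_validity_total (F : ltl (var I O)) :
  exists bs, check_validity F bs.
Proof.
have [vF|/not_all_ex_not [s nF]] := classic (valid F).
  by exists (true, fun _ _ => false); exact: check_valid.
by exists (false, s); exact: check_invalid.
Qed.

Section Execution.
Variable post : config I O -> Prop.
Notation terminates := (inevitably (step phi) post).

(** [B] collects the variables bound so far. As [t] agrees with the primed copies on [B], a
    candidate lies outside [B], so each failed check shrinks [~: B]. The first premise is what the
    caller must supply for the returned [z]. *)
Lemma terminates_Parse cl V :
  (forall z, z \notin V ->
     (forall W, independent phi W -> V \subset W -> z \in W) ->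
     terminates (Inner cl (V :|: [set z]))) ->
  forall B binds t,
    (forall s, sat s 0 binds <-> exists2 y, y \in B & differs s y) ->
    ~ sat t 0 (independence_formula phi V) ->
    (forall y, y \in B -> ~ differs t y) ->
    terminates (Parse cl V binds t).
Proof.
move=> termV B; have [n] := ubnP #|~: B|.
elim: n B => // n IH B ltBn binds t bindsE refV agree.
have bindsE' z s : sat s 0 (Or binds (differ I z)) <->
    exists2 y, y \in z |: B & differs s y.
  rewrite sat_Or bindsE sat_differ; split=> [[[y yB]|]|[y]].
  - by exists y; rewrite // setU1r.
  - by exists z; rewrite // setU11.
  - by case/setU1P => [->|yB]; [right | left; exists y].
apply: inevitably_later.
  have [z cz] := candidate_exists refV.
  have [[[] t'] ct'] := check_validity_total
    (Or (Or binds (differ I z)) (independence_formula phi V)).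
  - by eexists; apply: step_parse_passed cz ct'.
  - by eexists; apply: step_parse_failed cz ct'.
move=> c' st; inversion st as [| | | |? ? ? ? z t' cz ct'|? ? ? ? z t' cz ct'|];
  subst; case/candidateE: cz => zV dz; inversion ct' as [? valF|? nF]; subst.
- have [nb nI] : ~ sat t' 0 (Or binds (differ I z)) /\
      ~ sat t' 0 (independence_formula phi V) by split=> ?; apply/nF/sat_Or; tauto.
  apply: (IH (z |: B)) => //; last by move=> y yB dy; apply/nb/bindsE'; exists y.
  have zB : z \notin B by apply/negP => /agree.
  apply: (@leq_trans #|~: B|) => //; apply: proper_card.
  by rewrite properC; apply/properUr; rewrite sub1set.
- apply: termV => // W indW subVW; apply: contraT => /negP zW.
  (* The check that passed yields no new trace, so its validity is tested on the reset of [t], which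
     still refutes independence. *)
  have := valF (pullback (unprime W) t) => /sat_Or [/bindsE' [y yB]|].
    move=> /differs_unprime [yW dy].
    by case/setU1P: yB => [eyz|/agree //]; rewrite -eyz in zW.
  by move/(refutes_unprime indW subVW refV).
Qed.

(** The returned variable lies outside [V], so [~: V] shrinks at each pass. *)
Lemma terminates_Inner cl x :
  (forall V, x \in V -> independent phi V ->
     (forall W, independent phi W -> x \in W -> V \subset W) ->
     post (Computed cl V)) ->
  forall V, x \in V ->
    (forall W, independent phi W -> x \in W -> V \subset W) ->
    terminates (Inner cl V).
Proof.
move=> postC V; have [n] := ubnP #|~: V|.
elim: n V => // n IH V ltVn xV minV; apply: inevitably_later.
  have [[[] t'] ct'] := check_validity_total (independence_formula phi V).
  - by eexists; apply: step_passed ct'.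
  - by eexists; apply: step_failed ct'.
move=> c' st; inversion st as [| |? ? t' ct'|? ? t' ct'| | |]; subst;
  inversion ct' as [? valF|? nF]; subst.
  by apply: inevitably_now; exact: postC.
(* [Bot] is the empty disjunction, matching no bound variables. *)
apply: (@terminates_Parse _ _ _ set0) => // [z zV forced|s|y]; last by rewrite inE.
  apply: IH; first 1 last.
  - by rewrite inE xV.
  - move=> W indW xW; rewrite subUset sub1set minV //=.
    by apply: forced => //; exact: minV.
  apply: (@leq_trans #|~: V|) => //; apply: proper_card.
  by rewrite properC; apply/properUl; rewrite sub1set.
by split=> // -[y]; rewrite inE.
Qed.
End Execution.
End Decomposition.

Theorem theorem1 (I : Type) (O : finType) (phi : ltl (I + O)) :
  satisfiable phi ->
  forall (cl : {set {set O}}) (R : {set O}),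
    reachable phi (Main cl R) -> R != set0 ->
    inevitably (step phi)
      (fun c => exists V : {set O},
         [/\ c = Computed cl V,
             independent phi V &
             forall U : {set O},
               U != set0 -> U \proper V -> ~ independent phi U])
      (Main cl R).
Proof.
move=> _ cl R _ Rn0; apply: inevitably_later.
  by have [x xR] := set0Pn _ Rn0; exists (Inner cl [set x]); exact: step_choose.
move=> c' st; inversion st as [|? ? x xR| | | | |]; subst.
  by rewrite eqxx in Rn0.
apply: (@terminates_Inner _ _ _ _ _ x) => [V xV indV minV||W _ xW]; first last.
- by rewrite sub1set.
- by rewrite inE.
exists V; split=> // U /set0Pn [y yU] /properP [/subsetP subUV [v vV vU]] indU.
have [xU|xU] := boolP (x \in U).
  by case/negP: vU; apply: (subsetP (minV U indU xU)).
have xUC : x \in ~: U by rewrite inE.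
(* Non-emptiness of [U] enters here: [y] lies in [U], hence in [V], hence in [~: U]. *)
have /subsetP/(_ y (subUV y yU)) := minV _ (independentC indU) xUC.
by rewrite inE yU.
Qed.
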